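(* Let $q=c/d$ be a rational number with $0<q\leq 1$ ($c,d$ positive integers), let $u=\lfloor d/c\rfloor$ and $A=\frac{\sum_{i=1}^c x^{1+i+\left\lfloor \frac{id}{c}\right\rfloor}}{1-x^{c+d}}$. Then the generating function $M(x)=\sum_{n\geq 1}m_nx^n$, where $m_n$ is the number of meet-irreducible elements of $\mathbb{W}_n^q$, is $$M(x)=\frac{x^{2+u}(x-1)A-(x-1)A^2+x^2}{(x-1)\left(x^{2+u}(1-A)+Ax^{3+u}+(x-1)(x+A-A^2)\right)}.$$
   Context: A $q$-decreasing word of length $n$ is a binary word of length $n$ in which every maximal factor $0^a1^b$ satisfies $a=0$ or $qa>b$; $\mathcal{W}_n^q$ is the set of them and $\mathbb{W}_n^q$ is this set with the componentwise order ($v\leq w$ iff $v_i\leq w_i$ for all $i$), which is a lattice. An element $P$ is meet-irreducible if $P=R\wedge S$ implies $P=R$ or $P=S$.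
   Formalization: The greatest element 1^n is not counted as meet-irreducible; the literal definition would count it and the formula would fail (for q=1, n=1 the literal count is 2, but the coefficient of x is 1). *)

(* Defs.v *)
From HB Require Import structures.
From mathcomp Require Import all_boot all_order all_algebra.
From mathcomp Require Import boolp classical_sets.
Set Implicit Arguments.
Unset Strict Implicit.
Unset Printing Implicit Defensive.
Import Order.TTheory GRing.Theory Num.Theory.
Local Open Scope ring_scope.

(** * Formal power series *)

(* [Fps a] is the series \sum_n (a n) x^n; the product is the Cauchy product.
   A wrapper is used rather than [nat -> R] so as not to pick up the pointwise
   ring structure on functions. *)
Record fps (R : Type) := Fps { fcoef : nat -> R }.

HB.instance Definition _ (R : Type) := gen_eqMixin (fps R).
HB.instance Definition _ (R : Type) := gen_choiceMixin (fps R).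

Lemma fpsP (R : Type) (f g : fps R) : (forall n, fcoef f n = fcoef g n) -> f = g.
Proof. by case: f g => [a] [b] /= ab; congr Fps; apply/funext. Qed.

Section FpsRing.
Variable R : comNzRingType.
Implicit Types f g h : fps R.

Definition fps_zero : fps R := Fps (fun=> 0).
Definition fps_opp f : fps R := Fps (fun n => - fcoef f n).
Definition fps_add f g : fps R := Fps (fun n => fcoef f n + fcoef g n).
Definition fps_one : fps R := Fps (fun n => (n == 0%N)%:R).
Definition fps_mul f g : fps R :=
  Fps (fun n => \sum_(i < n.+1) fcoef f i * fcoef g (n - i)).
Definition fpsX : fps R := Fps (fun n => (n == 1%N)%:R).

Fact fps_addA : associative fps_add.
Proof. by move=> f g h; apply: fpsP => n /=; rewrite addrA. Qed.

Fact fps_addC : commutative fps_add.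
Proof. by move=> f g; apply: fpsP => n /=; rewrite addrC. Qed.

Fact fps_add0 : left_id fps_zero fps_add.
Proof. by move=> f; apply: fpsP => n /=; rewrite add0r. Qed.

Fact fps_addN : left_inverse fps_zero fps_opp fps_add.
Proof. by move=> f; apply: fpsP => n /=; rewrite addNr. Qed.

HB.instance Definition _ :=
  GRing.isZmodule.Build (fps R) fps_addA fps_addC fps_add0 fps_addN.

Definition fps_trunc N f : {poly R} := \poly_(i < N.+1) fcoef f i.

Lemma coef_fps_trunc N f n : (n <= N)%N -> (fps_trunc N f)`_n = fcoef f n.
Proof. by move=> nN; rewrite coef_poly ltnS nN. Qed.

Lemma fps_mulE N f g n : (n <= N)%N ->
  fcoef (fps_mul f g) n = (fps_trunc N f * fps_trunc N g)`_n.
Proof.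
move=> nN; rewrite coefM /=; apply: eq_bigr => i _.
by rewrite !coef_fps_trunc // (leq_trans _ nN) // ?leq_subr // -ltnS.
Qed.

Fact fps_mulC : commutative fps_mul.
Proof. by move=> f g; apply: fpsP => n; rewrite !(@fps_mulE n) // mulrC. Qed.

Fact fps_mulA : associative fps_mul.
Proof.
move=> f g h; apply: fpsP => n.
have -> : fcoef (fps_mul f (fps_mul g h)) n =
    (fps_trunc n f * (fps_trunc n g * fps_trunc n h))`_n.
  rewrite coefM /=; apply: eq_bigr => i _.
  rewrite -fps_mulE ?leq_subr //=.
  by rewrite coef_fps_trunc // -ltnS.
rewrite mulrA coefM /=; apply: eq_bigr => i _.
rewrite -fps_mulE -1?ltnS //=.
by rewrite coef_fps_trunc // leq_subr.
Qed.

Fact fps_mul1 : left_id fps_one fps_mul.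
Proof.
move=> f; apply: fpsP => n /=; rewrite big_ord_recl /= mul1r subn0.
by rewrite big1 ?addr0 // => i _; rewrite mul0r.
Qed.

Fact fps_mulDl : left_distributive fps_mul fps_add.
Proof.
move=> f g h; apply: fpsP => n /=; rewrite -big_split /=.
by apply: eq_bigr => i _; rewrite mulrDl.
Qed.

Fact fps_one_neq0 : fps_one != 0.
Proof.
by apply/eqP => /(congr1 (fun f => fcoef f 0)) /eqP; rewrite /= oner_eq0.
Qed.

HB.instance Definition _ := GRing.Zmodule_isComNzRing.Build (fps R)
  fps_mulA fps_mulC fps_mul1 fps_mulDl fps_one_neq0.

Definition fps_unit : pred (fps R) := fun f => `[< exists g, g * f = 1 >].

Definition fps_inv f : fps R :=
  if pselect (exists g, g * f = 1) is left fU then projT1 (cid fU) else f.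

Fact fps_mulV : {in fps_unit, left_inverse 1 fps_inv *%R}.
Proof.
move=> f /asboolP fU; rewrite /fps_inv.
by case: pselect => // fU'; case: cid.
Qed.

Fact fps_unitP f g : g * f = 1 -> fps_unit f.
Proof. by move=> gf1; apply/asboolP; exists g. Qed.

Fact fps_inv_out : {in [predC fps_unit], fps_inv =1 id}.
Proof.
move=> f /negP fNU; rewrite /fps_inv; case: pselect => // fU.
by case: fNU; apply/asboolP.
Qed.

HB.instance Definition _ := GRing.ComNzRing_hasMulInverse.Build (fps R)
  fps_mulV fps_unitP fps_inv_out.

End FpsRing.

Section FpsDomain.
Variable R : idomainType.

Lemma fps_valuation (f : fps R) : f != 0 ->
  exists2 n, fcoef f n != 0 & forall i, (i < n)%N -> fcoef f i = 0.
Proof.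
move=> f0; have ex : exists n, fcoef f n != 0.
  apply: contrapT => nex; case/eqP: f0; apply: fpsP => n /=.
  by apply/eqP/negPn/negP => fn; apply: nex; exists n.
case: (ex_minnP ex) => n fn min; exists n => // i; rewrite ltnNge => ni.
by apply/eqP; apply: contraNT ni; apply: min.
Qed.

Fact fps_integral : GRing.integral_domain_axiom (fps R).
Proof.
move=> f g fg0; apply/norP => -[/fps_valuation[m fm mP] /fps_valuation[n gn nP]].
have /(congr1 (fun h => fcoef h (m + n))) /= := fg0.
have mlt : (m < (m + n).+1)%N by rewrite ltnS leq_addr.
rewrite (bigD1 (Ordinal mlt)) //= addKn big1 ?addr0 => [/eqP|i im].
  by rewrite mulf_eq0 (negPf fm) (negPf gn).
have [/mP->|mi] := ltnP i m; first by rewrite mul0r.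
have {}mi : (m < i)%N by rewrite ltn_neqAle mi eq_sym andbT.
by rewrite [X in _ * X]nP ?mulr0 // ltn_subLR ?ltn_add2r // -ltnS.
Qed.

HB.instance Definition _ :=
  GRing.ComUnitRing_isIntegral.Build (fps R) fps_integral.

End FpsDomain.

(** * q-decreasing words *)

(* The letters 0 and 1 are [false] and [true]. *)
Definition zeros_ones (a b : nat) : seq bool := nseq a false ++ nseq b true.

(* The occurrence w = p ++ 0^a 1^b ++ s is not properly contained in another
   occurrence in w of a factor of the form 0^a' 1^b'. *)
Definition maximal_factor (w p : seq bool) (a b : nat) (s : seq bool) : Prop :=
  w = p ++ zeros_ones a b ++ s /\
  forall p' a' b' s', w = p' ++ zeros_ones a' b' ++ s' ->
    (size p' <= size p)%N -> (size s' <= size s)%N -> p' = p /\ s' = s.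

Definition q_decreasing (q : rat) (w : seq bool) : Prop :=
  forall p a b s, maximal_factor w p a b s -> a = 0%N \/ b%:R < q * a%:R.

(* [n.-tupleprod bool] is [n.-tuple bool] with the componentwise order. *)
Record qword (q : rat) (n : nat) :=
  QWord { qword_val : n.-tupleprod bool; _ : `[< q_decreasing q qword_val >] }.

Fact qword_display : Order.disp_t. Proof. exact: Order.Disp tt tt. Qed.

HB.instance Definition _ q n := [isSub for @qword_val q n].
HB.instance Definition _ q n := [Finite of qword q n by <:].
HB.instance Definition _ q n :=
  [SubChoice_isSubPOrder of qword q n by <: with qword_display].

Lemma le_qwordE q n (v w : qword q n) :
  (v <= w)%O = [forall i, tnth (val v) i ==> tnth (val w) i].
Proof.
rewrite leEsub Order.TupleProdOrder.Exports.leEtprod; apply: eq_forallb => i.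
by rewrite leEbool; case: (tnth _ i); case: (tnth _ i).
Qed.

Definition is_meet (d : Order.disp_t) (T : porderType d) (P R S : T) : Prop :=
  infimums [set R; S]%classic P.

Lemma is_meetE d (T : porderType d) (P R S : T) :
  is_meet P R S <->
  [/\ (P <= R)%O, (P <= S)%O &
      forall Q, (Q <= R)%O -> (Q <= S)%O -> (Q <= P)%O].
Proof.
split=> [[l u]|[PR PS m]].
  split; [by apply: l; left| by apply: l; right|move=> Q QR QS].
  by apply: u => _ [->|->].
split; first by move=> _ [->|->].
by move=> Q lQ; apply: m; apply: lQ; [left|right].
Qed.

(* As usual in lattice theory, the greatest element (the empty meet) is not
   counted as meet-irreducible. *)
Definition meet_irreducible (d : Order.disp_t) (T : porderType d) (P : T) :
    Prop :=
  ~ (forall Q : T, (Q <= P)%O) /\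
  (forall R S : T, is_meet P R S -> P = R \/ P = S).

Definition num_meet_irreducible (q : rat) (n : nat) : nat :=
  #|[set P : qword q n | `[< meet_irreducible P >]]|.

(* \sum_(n >= 1) m_n x^n *)
Definition meet_irreducible_gf (q : rat) : fps rat :=
  Fps (fun n => if n == 0%N then 0 else (num_meet_irreducible q n)%:R).

(* Main.v *)
Require Import Defs.
From mathcomp Require Import all_boot all_order all_algebra.
From mathcomp Require Import fraction boolp zify ring.

(** A word is q-decreasing iff each of its blocks 0^a 1^b with a > 0 satisfies
    alpha b <= a, where alpha b = floor (b d / c) + 1; a word is meet-irreducible
    iff it is 1^k V where V is nonempty, begins with 0 and is maximal among the
    q-decreasing words of its length that begin with 0.  Such V are recognised
    locally: every block satisfies alpha b <= a <= alpha (b + 1), and a block with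
    b > 0 and a = alpha (b + 1) (its run of ones could be lengthened) is last or
    followed by a tight block, one with b > 0 and a = alpha b.  Tight blocks have
    generating function A; with t = x^(2 + u), blocks with b > 0 sum to t / (1 - x)
    and those with a = alpha (b + 1) to (A - t) / x, which gives a linear system
    for the generating function of the words V. *)

Set Implicit Arguments.
Unset Strict Implicit.
Unset Printing Implicit Defensive.
Import Order.TTheory GRing.Theory Num.Theory.

(** * Block decomposition of a word *)

(* The pair (a, b) stands for 0^a 1^b: only the first block may have a = 0, and
   only the last one may have b = 0. *)
Fixpoint blocks (w : bitseq) : seq (nat * nat) :=
  match w with
  | [::] => [::]
  | false :: w' => if blocks w' is (a, b) :: l then (a.+1, b) :: l else [:: (1, 0)]
  | true :: w' => if blocks w' is (0, b) :: l then (0, b.+1) :: l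
                  else (0, 1) :: blocks w'
  end.

Definition word_of (l : seq (nat * nat)) : bitseq :=
  flatten [seq zeros_ones ab.1 ab.2 | ab <- l].

Lemma word_of_cons a b l : word_of ((a, b) :: l) = zeros_ones a b ++ word_of l.
Proof. by []. Qed.

(** The block lists of words that are empty or begin with 0; [canonical_blocks0] and [word_ofK] make
    [blocks] and [word_of] inverse bijections between the two. *)
Fixpoint canonical (l : seq (nat * nat)) : bool :=
  if l is (a, b) :: l' then
    [&& 0 < a, (0 < b) || (l' == [::]) & canonical l'] else true.

Lemma blocksK : cancel blocks word_of.
Proof.
elim=> [|[] w IH] //=; last first.
  by case E: (blocks w) IH => [|[a b] l] /= <-.
case E: (blocks w) IH => [|[[|a] b] l] /= <-//.
Qed.

Lemma blocks_nil w : blocks w = [::] -> w = [::].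
Proof. by move=> E; rewrite -(blocksK w) E. Qed.

Lemma canonical_blocks w :
  canonical (blocks w) \/
  exists b l, [/\ blocks w = (0, b.+1) :: l & canonical l].
Proof.
elim: w => [|[] w IH]; [by left| |] => /=.
  right; case: IH => [|[b [l [-> Hl]]]]; last by exists b.+1, l.
  case: (blocks w) => [|[[|a] b] l] //= H; first by exists 0, [::].
  by exists 0, ((a.+1, b) :: l).
left; case: IH => [|[b [l [-> Hl]]]] //=.
by case: (blocks w) => [|[[|a] b] l] //=.
Qed.

Definition starts0 (w : bitseq) := ~~ head false w.

Lemma canonical_blocks0 w : starts0 w -> canonical (blocks w).
Proof.
case: w => [|[] w] //= _; case: (canonical_blocks (false :: w)) => // -[b [l []]] /=.
by case: (blocks w) => [|[? ?] ?].
Qed.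

Lemma starts0_word_of l : canonical l -> starts0 (word_of l).
Proof. by case: l => [|[[|a] b] l]. Qed.

Lemma blocks_zeros_ones a b w : 0 < b -> 0 < a -> starts0 w ->
  blocks (zeros_ones a b ++ w) = (a, b) :: blocks w.
Proof.
move=> b0 a0 w0.
have Hb : blocks (nseq b true ++ w) = (0, b) :: blocks w.
  elim: b b0 => [|[|b] IH] // _; last by rewrite /= in IH *; rewrite IH.
  by case: w w0 IH => [|[] w] //= _ _; case: (blocks w) => [|[]].
rewrite /zeros_ones -catA.
by elim: a a0 => [|[|a] IH] // _; rewrite /= in IH *; rewrite ?Hb ?IH.
Qed.

Lemma blocks_zeros a : blocks (nseq a.+1 false) = [:: (a.+1, 0)].
Proof. by elim: a => [|a IH] //; rewrite /= in IH *; rewrite IH. Qed.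

Lemma word_ofK l : canonical l -> blocks (word_of l) = l.
Proof.
elim: l => [|[a b] l IH] // /and3P[a0 /orP[b0|/eqP->] Hl].
  by rewrite word_of_cons blocks_zeros_ones ?IH // starts0_word_of.
case: b => [|b].
  by case: a a0 => // a _; rewrite word_of_cons /zeros_ones !cats0 blocks_zeros.
by rewrite word_of_cons blocks_zeros_ones.
Qed.

(** The default [true] admits an empty [p]. The cut falls at the end of a run of ones or at an end
    of the word, so no block straddles it. *)
Lemma blocks_cat p w : last true p -> starts0 w -> blocks (p ++ w) = blocks p ++ blocks w.
Proof.
case: w => [|[] w] //; first by rewrite !cats0.
move=> + _; elim: p => [|x p IH] //.
case: p IH => [|y p] IH /= Hl.
  by case: x Hl => // _; rewrite /=; case: (blocks w) => [|[]].
have {}IH := IH Hl; rewrite -/(blocks (y :: p)) -/(blocks (y :: p ++ false :: w)).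
rewrite -cat_cons IH -/(blocks (false :: w)).
have: blocks (y :: p) <> [::] by move/blocks_nil.
by case: x {Hl}; case: (blocks (y :: p)) => [|[[|a] b] l].
Qed.

(** * Componentwise comparison of words *)

Definition below (v w : bitseq) :=
  size v = size w /\ forall i, nth false v i -> nth false w i.

Lemma nth_zeros_ones a b w i : nth false (zeros_ones a b ++ w) i =
  if i < a then false else if i < a + b then true else nth false w (i - (a + b)).
Proof.
rewrite /zeros_ones -catA nth_cat size_nseq nth_nseq; case: ltnP => // ai.
rewrite nth_cat size_nseq nth_nseq.
have ->: (i - a < b) = (i < a + b) by lia.
by case: ltnP => // abi; congr nth; lia.
Qed.

Lemma size_zeros_ones a b : size (zeros_ones a b) = a + b.
Proof. by rewrite size_cat !size_nseq. Qed.

Lemma canonical_nth0 l : canonical l -> nth false (word_of l) 0 = false.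
Proof. by case: l => [|[[|a] b] l]. Qed.

Lemma ones_above a b v e f w :
  (forall i, nth false (zeros_ones a b ++ v) i -> nth false (zeros_ones e f ++ w) i) ->
  forall i, a <= i < a + b -> (e <= i) && ((i < e + f) || nth false w (i - (e + f))).
Proof.
move=> H i /andP[ai iab]; have := H i.
rewrite !nth_zeros_ones ltnNge ai iab /= => /(_ isT).
by case: ltnP => //= _; case: ltnP.
Qed.

(** The f extra ones of the upper word absorb the first f letters of [v]. *)
Lemma below_block a b v f w : below (zeros_ones a b ++ v) (zeros_ones a (b + f) ++ w) ->
  f <= size v /\ below (drop f v) w.
Proof.
move=> [+ H]; rewrite !size_cat !size_nseq => sz.
have fv : f <= size v by lia.
split=> //; split; first by rewrite size_drop; lia.
move=> i; rewrite nth_drop => Hi; have := H (a + b + f + i).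
rewrite !nth_zeros_ones.
have ->: (a + b + f + i < a) = false by lia.
have ->: (a + b + f + i < a + b) = false by lia.
have ->: (a + b + f + i < a + (b + f)) = false by lia.
have ->: a + b + f + i - (a + b) = f + i by lia.
have ->: a + b + f + i - (a + (b + f)) = i by lia.
by apply.
Qed.

(** * Valid block lists and maximality *)

(* [alpha b] is the least number of zeros allowed before a run of b ones. *)
Section Blocks.
Variable alpha : nat -> nat.
Hypothesis alpha0 : alpha 0 = 1.
(** For floor (b d / c) + 1, this is where q <= 1 enters, and [alpha_add1] is the inequality floor
    (y + z) <= floor y + floor z + 1. *)
Hypothesis alpha_lt : forall b, alpha b < alpha b.+1.
Hypothesis alpha_add1 : forall b, alpha b.+1 <= alpha b + alpha 1.

Lemma alpha_homo b b' : b <= b' -> alpha b <= alpha b'.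
Proof.
move=> /subnKC <-; elim: (b' - b) => [|k IH]; first by rewrite addn0.
by rewrite addnS; apply: leq_trans IH (ltnW (alpha_lt _)).
Qed.

Lemma alpha_gt0 b : 0 < alpha b.
Proof. by apply: leq_trans (alpha_homo (leq0n b)); rewrite alpha0. Qed.

Lemma alpha_inj b b' : alpha b < alpha b'.+1 -> b <= b'.
Proof. by move=> H; rewrite leqNgt; apply/negP => /alpha_homo; lia. Qed.

Definition good_block (ab : nat * nat) := (ab.1 == 0) || (alpha ab.2 <= ab.1).
Definition decreasing (w : bitseq) := all good_block (blocks w).

Lemma decreasing_cons1 w : decreasing (true :: w) = decreasing w.
Proof. by rewrite /decreasing /=; case: (blocks w) => [|[[|a] b] l]. Qed.

Lemma decreasing_ones k w : decreasing (nseq k true ++ w) = decreasing w.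
Proof. by elim: k => //= k IH; rewrite decreasing_cons1. Qed.

Lemma decreasing_zeros k : decreasing (nseq k false).
Proof. by case: k => // k; rewrite /decreasing blocks_zeros /= /good_block /= alpha0. Qed.

Lemma decreasing_block a b w : 0 < b -> starts0 w -> 0 < a ->
  decreasing (zeros_ones a b ++ w) = (alpha b <= a) && decreasing w.
Proof.
move=> b0 w0 a0; rewrite /decreasing blocks_zeros_ones //= {1}/good_block /=.
by case: a a0.
Qed.

(** The value on the empty list allows a block with a = alpha (b + 1) to be last. *)
Definition starts_tight (l : seq (nat * nat)) : bool :=
  if l is (a, b) :: _ then (a == alpha b) && (0 < b) else true.

Fixpoint valid (l : seq (nat * nat)) : bool :=
  if l is (a, b) :: l' then
    [&& alpha b <= a <= alpha b.+1, (a == alpha b.+1) ==> starts_tight l' & valid l']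
  else true.

Lemma valid_good l : valid l -> all good_block l.
Proof.
elim: l => [|[a b] l IH] //= /and3P[/andP[H _] _ /IH ->].
by rewrite /good_block /= H orbT.
Qed.

(* Here [p := size (x1 ++ x2)] is a zero that may be switched on alone, and
   filling the whole prefix [x1] leaves that zero untouched. *)
Lemma not_valid_split l : canonical l -> all good_block l -> ~~ valid l ->
  exists x1 x2 y, [/\ word_of l = x1 ++ x2 ++ false :: y, x1 <> [::],
     decreasing (x1 ++ x2 ++ true :: y) & decreasing (x2 ++ false :: y)].
Proof.
elim: l => [|[a b] l IH] // /= /and3P[a0 bl cl] /andP[Gab Gl].
have {}Gab : alpha b <= a by move: Gab a0; rewrite /good_block /=; case: a.
rewrite Gab /= word_of_cons.
have l0 := starts0_word_of cl.
have dl : decreasing (word_of l) by rewrite /decreasing word_ofK.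
case: leqP => [aM|aM] /=; last first.
  move=> _; have b1 := alpha_gt0 b.+1.
  (* Here a - 1 >= alpha (b + 1): the last zero of the block can become a one, and filling only its
     first zero still leaves a - 1 zeros. *)
  exists [:: false], (nseq (a - 2) false), (nseq b true ++ word_of l); split => //.
  - have E : a = 1 + (a - 2) + 1 by lia.
    by rewrite /zeros_ones [in LHS]E !nseqD -!catA.
  - have ->: [:: false] ++ nseq (a - 2) false ++ true :: nseq b true ++ word_of l
        = zeros_ones a.-1 b.+1 ++ word_of l.
      have ->: a.-1 = 1 + (a - 2) by lia.
      by rewrite /zeros_ones nseqD -!catA.
    rewrite decreasing_block // ?dl; lia.
  - have ->: nseq (a - 2) false ++ false :: nseq b true ++ word_of l
        = zeros_ones a.-1 b ++ word_of l.
      have ->: a.-1 = (a - 2) + 1 by lia.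
      by rewrite /zeros_ones nseqD -!catA.
    have := alpha_lt b.
    case: b bl {Gab b1} aM => [|b] bl aM lt.
      move: bl => /= /eqP ->; rewrite /zeros_ones !cats0; exact: decreasing_zeros.
    rewrite decreasing_block // ?dl; lia.
rewrite negb_and negb_imply; case: (boolP (valid l)) => vl /=; last first.
  move=> _; have [x1 [x2 [y [E n1 D1 D2]]]] := IH cl Gl vl.
  have b0 : 0 < b by case/orP: bl => // /eqP l_nil; rewrite l_nil in vl.
  (* Since [x1] is nonempty, the modified tail still begins with 0 and the block (a, b) is
     unaffected. *)
  exists (zeros_ones a b ++ x1), x2, y; split => //.
  - by rewrite E catA.
  - by case: x1 n1 {D1 E} => //; rewrite /zeros_ones; case: a a0 {Gab aM}.
  rewrite -catA decreasing_block // ?Gab //.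
  by move: l0; rewrite E; case: x1 n1 {D1 E}.
rewrite orbF => /andP[/eqP aE]; case: l cl Gl bl {IH vl} l0 dl => [|[a2 b2] l] //=.
rewrite orbF => /and3P[a20 bl2 cl] /andP[G2 Gl] b0 l0 dl nt.
have {}G2 : alpha b2 <= a2 by move: G2 a20; rewrite /good_block /=; case: a2 {l0 dl nt}.
(* The first zero of the next block becomes a one of this block, which has enough zeros for b + 1
   ones; the next block is not tight, so b2 = 0 or a2 - 1 >= alpha b2. *)
exists (zeros_ones a b), [::], (nseq a2.-1 false ++ nseq b2 true ++ word_of l); split.
- by rewrite word_of_cons /zeros_ones; case: a2 a20 {G2 nt dl l0} => //= a2; rewrite -!catA.
- by case: a a0 {Gab aM aE}.
- have ->: zeros_ones a b ++ [::] ++ true :: nseq a2.-1 false ++ nseq b2 true ++ word_of l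
     = zeros_ones a b.+1 ++ (nseq a2.-1 false ++ nseq b2 true ++ word_of l).
    rewrite /zeros_ones -addn1 nseqD -!catA; done.
  case: (posnP b2) => b20; last first.
    have aa := alpha_gt0 b2.
    rewrite decreasing_block // -?aE ?leqnn;
      last by case: a2 a20 G2 nt {dl l0} => [|[|a2]] //=; lia.
    rewrite catA -/(zeros_ones _ _) decreasing_block //; try lia.
      rewrite /decreasing word_ofK // Gl; lia.
    exact: starts0_word_of.
  rewrite b20 /= in bl2 *; rewrite (eqP bl2) /= cats0.
  rewrite decreasing_block // -?aE ?leqnn ?decreasing_zeros //.
  by case: a2.-1.
- move: dl; rewrite word_of_cons /zeros_ones.
  by case: a2 a20 {G2 nt l0} => //= a2; rewrite -!catA.
Qed.

Lemma first_block_good e f l :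
  canonical ((e, f) :: l) -> all good_block ((e, f) :: l) -> alpha f <= e.
Proof. by rewrite /good_block; case: e => //= e _ /andP[]. Qed.

(* The two alternatives: the last zero of the upper word before position a + b is in
   its first block, or in a later one, which then consumes alpha b more zeros. *)
Lemma first_block_above a b e f l : 0 < b ->
  canonical ((e, f) :: l) -> all good_block ((e, f) :: l) ->
  (forall i, a <= i < a + b ->
     (e <= i) && ((i < e + f) || nth false (word_of l) (i - (e + f)))) ->
  (e <= a /\ a + b <= e + f) \/ (0 < f /\ e + f + alpha b <= a).
Proof.
move=> b0; elim: l a e f => [|[e' f'] l IH] a e f /= /and3P[e0 fl cl] /andP[Gef Gl] H.
- left; have /andP[ea _] := H a ltac:(lia); split=> //.
  have := H (a + b).-1 ltac:(lia); rewrite nth_nil orbF; lia.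
have f0 : 0 < f by case/orP: fl.
have /andP[ea Ha] := H a ltac:(lia).
have [efa|efa] := leqP (e + f) a.
  have n0 := @canonical_nth0 ((e', f') :: l) cl.
  have efa' : e + f < a.
    rewrite ltn_neqAle efa andbT; apply/eqP => E; move: Ha.
    by rewrite E ltnn subnn /= n0.
  right; split=> //.
  have Gf := first_block_good cl Gl.
  have [||] := IH (a - (e + f)) e' f' cl Gl; last 2 first.
  (* The run of b ones lies within the ones of this block, so b <= f' and alpha b <= alpha f' <=
     e'. *)
  + move=> [e'a e'f]; have := @alpha_homo b f' ltac:(lia); lia.
  + by move=> [_ ?]; lia.
  + move=> i ir; have := H (i + (e + f)) ltac:(lia).
    rewrite addnK => /andP[_ /orP[|]]; first lia.
    rewrite word_of_cons nth_zeros_ones; by case: (ltnP i e').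
left; split=> //; rewrite leqNgt; apply/negP => efb.
(* Position e + f, the first zero of the next block, would lie in the run that has to be covered. *)
have /= := H (e + f) ltac:(lia).
by rewrite ltnn subnn (@canonical_nth0 ((e', f') :: l) cl) andbF.
Qed.

(** Induction on the first block (a, b), whose ones must be covered by ones of the upper word. If
    its first block (e, f) covers them, then e = a and f is b or b + 1; f = b leaves the tails to
    compare, and f = b + 1 takes a zero away from a tight block, which is impossible. A later block
    cannot cover them for lack of zeros. *)
Lemma valid_maximal l l' : canonical l -> valid l ->
  canonical l' -> all good_block l' ->
  below (word_of l) (word_of l') -> l = l'.
Proof.
elim: l l' => [|[a b] l IH] [|[e f] l'] //.
- by move=> _ _ /= /and3P[e0 _ _] _ []; rewrite word_of_cons !size_cat size_nseq /=; lia.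
- by move=> /= /and3P[a0 _ _] _ _ _ []; rewrite word_of_cons !size_cat size_nseq /=; lia.
move=> c1 v1 c2 G2 Hbel; have [Hsz Hnth] := Hbel.
have /= /and3P[a0 bl cl] := c1; have /= /and3P[e0 fl cl'] := c2.
have /= /and3P[/andP[ab aB] /implyP slack vl] := v1.
have /= /andP[Gef Gl'] := G2.
have {}Gef := first_block_good c2 G2.
move: Hsz Hnth Hbel; rewrite !word_of_cons.
have [b0|b0] := posnP b.
  move: bl; rewrite b0 /= => /eqP l_nil; rewrite l_nil /= => Hsz Hnth Hbel.
  have f0 : f = 0.
    case: (posnP f) => // f0; have := alpha_homo f0.
    by move: Hsz; rewrite !size_cat !size_nseq b0 /= in aB *; lia.
  move: fl; rewrite f0 /= => /eqP l'_nil.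
  move: Hsz; rewrite l'_nil f0 !size_cat !size_nseq /= !addn0 => ->; done.
move=> Hsz Hnth Hbel.
have [|[+ +]|[+ +]] := @first_block_above a b e f l' b0 c2 G2.
  exact: ones_above Hnth.
- move=> ea abf.
  have eE : e = a.
    apply/eqP; rewrite eqn_leq ea /= leqNgt; apply/negP => ea'.
    have := @alpha_homo b.+1 f ltac:(lia); lia.
  rewrite eE in Hbel Hsz Hnth Gef abf *.
  have fb : f <= b.+1 by apply: alpha_inj; have := alpha_lt b.+1; lia.
  have fE : f = b + (f - b) by lia.
  move: Hbel; rewrite fE => /below_block[fv bel].
  have [E|NE] := eqVneq f b.
    by rewrite E subnn drop0 addn0 in bel *; rewrite (IH l').
  have fb1 : f = b.+1 by lia.
  have aE : a == alpha b.+1 by rewrite eqn_leq aB -fb1.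
  have := slack aE; case: l {IH c1 v1 bl vl slack Hnth} cl fv bel Hsz => [|[a2 b2] l].
    by move=> _ /=; lia.
  rewrite fb1 subSnn /= word_of_cons => /and3P[a20 bl2 cl] _ bel Hsz /andP[/eqP a2E b20].
  (* The extra one of the upper word absorbs the first zero of the tight block (a2, b2), and alpha
     b2 - 1 positions are too few for the zeros required before b2 ones. *)
  have {}bel : below (zeros_ones a2.-1 b2 ++ word_of l) (word_of l').
    by move: bel; case: a2 a20 {a2E Hsz} => //= a2 _; rewrite drop0.
  case: l' {c2 G2 Hsz fl} cl' Gl' bel => [|[e2 f2] l'] cl' Gl' bel.
    by case: bel; rewrite !size_cat !size_nseq /=; lia.
  have Gf2 := first_block_good cl' Gl'.
  have [|[+ +]|[+ +]] := @first_block_above a2.-1 b2 e2 f2 l' b20 cl' Gl'.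
  + exact: ones_above bel.2.
  + move=> ? ?; have := @alpha_homo b2 f2 ltac:(lia); lia.
  + lia.
(* Here e >= alpha f >= alpha 1, so a >= alpha 1 + 1 + alpha b, against a <= alpha (b + 1) <= alpha
   b + alpha 1. *)
- move=> f0 Hef; have := alpha_add1 b; have := alpha_homo f0; lia.
Qed.

End Blocks.

(** * Meet-irreducible words *)

Lemma last_zeros_ones x a b : 0 < b -> last x (zeros_ones a b) = true.
Proof.
case: b => // b _; rewrite last_cat /= -[X in last X _]/true.
by elim: b.
Qed.

Lemma canonical_split l1 a b l2 : canonical (l1 ++ (a, b) :: l2) ->
  last true (word_of l1) /\ canonical ((a, b) :: l2).
Proof.
elim: l1 => [|[a1 b1] l1 IH]; first by [].
move=> /= /and3P[_ b1_gt0 /IH[ll ?]]; split=> //.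
rewrite word_of_cons last_cat last_zeros_ones //.
by case: l1 b1_gt0 {IH ll} => [|? ?]; rewrite orbF.
Qed.

Lemma blocks_split w l1 a b l2 : blocks w = l1 ++ (a, b) :: l2 -> 0 < a ->
  [/\ last true (word_of l1), starts0 (word_of l2) &
      (0 < b) || (word_of l2 == [::])].
Proof.
move=> E a0; suff [H1 /= /and3P[_ H2 H3]] :
    last true (word_of l1) /\ canonical ((a, b) :: l2).
  by split=> //; [apply: starts0_word_of | case: (0 < b) H2 => //= /eqP ->].
case: (canonical_blocks w); rewrite E; first exact: canonical_split.
case=> [b' [l [+ cl]]]; case: l1 E => [|[a1 b1] l1] E /=.
  by move=> [aE]; rewrite aE in a0.
case=> -> -> lE; rewrite -lE in cl; have [H1 ?] := canonical_split cl.
by split=> //; rewrite word_of_cons last_cat last_zeros_ones.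
Qed.

Lemma nth_factor p a b s i : size p <= i -> i < size p + a + b ->
  nth false (p ++ zeros_ones a b ++ s) i = (size p + a <= i).
Proof.
move=> pi ip; rewrite nth_cat ltnNge pi /= nth_zeros_ones.
case: ltnP => ia; first lia.
case: ltnP => ib; lia.
Qed.

(** A larger occurrence would contain a 1 directly before a 0, at the junction with [p] or with
    [s]. *)
Lemma maximal_factorP p a b s : 0 < a -> last true p -> starts0 s ->
  (0 < b) || (s == [::]) -> maximal_factor (p ++ zeros_ones a b ++ s) p a b s.
Proof.
move=> a0 lp s0 bs; split=> // p' a' b' s' E pp ss.
have sz := congr1 size E; rewrite !size_cat !size_nseq in sz.
have np i (H : size p' <= i < size p' + a' + b') :
    nth false (p ++ zeros_ones a b ++ s) i = (size p' + a' <= i).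
  by rewrite E nth_factor //; case/andP: H.
have pE : size p' = size p.
  apply/eqP; rewrite eqn_leq pp leqNgt; apply/negP => lt.
  have := np (size p).-1 ltac:(lia); have := np (size p) ltac:(lia).
  rewrite nth_factor ?leqnn //; last lia.
  rewrite nth_cat; have -> : ((size p).-1 < size p) by lia.
  rewrite (set_nth_default true) ?nth_last ?lp; lia.
have sE : size s' = size s.
  apply/eqP; rewrite eqn_leq ss leqNgt; apply/negP => lt.
  have b0 : 0 < b by case/orP: bs => // /eqP sn; rewrite sn in lt.
  have := np (size p + a + b).-1 ltac:(lia); rewrite nth_factor; [|lia|lia].
  have := np (size p + a + b) ltac:(lia); rewrite !nth_cat size_cat !size_nseq.
  have ->: (size p + a + b < size p) = false by lia.
  have ->: (size p + a + b - size p < a + b) = false by lia.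
  have ->: size p + a + b - size p - (a + b) = 0 by lia.
  by rewrite nth0 (negPf s0); lia.
move/eqP: E; rewrite eqseq_cat // => /andP[/eqP -> H]; split=> //.
by move: H; rewrite eqseq_cat ?size_zeros_ones; [case/andP => _ /eqP|lia].
Qed.

(** If [p] ended with 0 or [s] began with 1, adding that letter to the factor would contradict
    maximality. *)
Lemma maximal_factor_blocks w p a b s : maximal_factor w p a b s ->
  0 < a -> 0 < b -> blocks w = blocks p ++ (a, b) :: blocks s.
Proof.
move=> [-> H] a0 b0.
have lp : last true p.
  case: (lastP p) H => //= p' [] H; first by rewrite last_rcons.
  have [] := H p' a.+1 b s.
  - by rewrite -cats1 -!catA.
  - by rewrite size_rcons.
  - by [].
  by move/(congr1 size); rewrite size_rcons; lia.
have s0 : starts0 s.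
  case: s H => [|[] s] //= H; have [] := H p a b.+1 s => //.
  - by rewrite /zeros_ones -addn1 nseqD -!catA.
  by move=> _ /(congr1 size) /=; lia.
rewrite blocks_cat ?blocks_zeros_ones //.
by case: a a0 {H}.
Qed.

Section MeetIrreducible.
Variables (alpha : nat -> nat) (q : rat).
Hypothesis alpha0 : alpha 0 = 1.
Hypothesis alpha_lt : forall b, alpha b < alpha b.+1.
Hypothesis alpha_add1 : forall b, alpha b.+1 <= alpha b + alpha 1.
Hypothesis alphaP : forall a b, (b%:R < q * a%:R)%R = (alpha b <= a).

Lemma q_decreasingE w : q_decreasing q w <-> decreasing alpha w.
Proof.
split=> [H|dw p a b s mf].
  apply/allP => -[a b] /splitPr.
  move E: (blocks w) => l ls; case: ls E => l1 l2 E.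
  rewrite /good_block /=; case: (posnP a) => //= a0.
  have [lp s0 bs] := blocks_split E a0.
  have := maximal_factorP a0 lp s0 bs.
  rewrite -word_of_cons -[X in maximal_factor X](_ : w = _); last first.
    by rewrite -[LHS]blocksK E /word_of map_cat flatten_cat.
  by move=> /H[aE|]; [rewrite aE in a0|rewrite alphaP].
have [|a0] := posnP a; [by left|right].
rewrite alphaP; have [->|b0] := posnP b; first by rewrite alpha0.
move: dw; rewrite /decreasing (maximal_factor_blocks mf) // all_cat /=.
by rewrite {2}/good_block /= => /and3P[_ + _]; case: a a0 {mf}.
Qed.

Variable n : nat.
Implicit Types P Q R S : qword q n.

Definition letters P : bitseq := qword_val P.

Lemma size_letters P : size (letters P) = n.
Proof. exact: size_tuple. Qed.

Lemma letters_inj : injective letters.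
Proof. by move=> P Q /val_inj E; apply: val_inj. Qed.

Lemma decreasing_letters P : decreasing alpha (letters P).
Proof. by apply/q_decreasingE; case: P => w Pw; apply/asboolP. Qed.

Lemma letters_surj w : size w = n -> decreasing alpha w -> exists P, letters P = w.
Proof.
move=> /eqP sw /q_decreasingE dw.
by exists (@QWord q n (Tuple sw) (introT (asboolP _) dw)).
Qed.

Lemma le_letters P Q :
  (P <= Q)%O <-> forall i, nth false (letters P) i -> nth false (letters Q) i.
Proof.
rewrite le_qwordE; split=> [/forallP H i|H]; last first.
  by apply/forallP => i; apply/implyP; rewrite !(tnth_nth false); apply: H.
have [ni|ni] := ltnP i n; last by rewrite nth_default ?size_letters.
by have := H (Ordinal ni); rewrite !(tnth_nth false) => /implyP.
Qed.

(** The value at the empty word rejects the all-ones word, which is the greatest element. *)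
Fixpoint irreducible_word (w : bitseq) : bool :=
  match w with
  | [::] => false
  | true :: w' => irreducible_word w'
  | false :: _ => valid alpha (blocks w)
  end.

Lemma irreducible_word_ones k w :
  irreducible_word (nseq k true ++ w) = irreducible_word w.
Proof. by elim: k. Qed.

Lemma ones_prefix w : exists k v, w = nseq k true ++ v /\ starts0 v.
Proof.
elim: w => [|[] w [k [v [-> v0]]]]; first by exists 0, [::].
  by exists k.+1, v.
by exists 0, (false :: nseq k true ++ v).
Qed.

Lemma nth_ones k v i : nth false (nseq k true ++ v) i = (i < k) || nth false v (i - k).
Proof. by rewrite nth_cat size_nseq nth_nseq; case: ltnP. Qed.

(** [Q] also begins with 1^k, and its remainder begins with 0 and lies above that of [P], so
    [valid_maximal] applies. *)
Lemma above_first_zero P Q k v : letters P = nseq k true ++ false :: v ->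
  valid alpha (blocks (false :: v)) -> (P <= Q)%O -> nth false (letters Q) k = false ->
  P = Q.
Proof.
move=> PE vv /le_letters PQ Qk; apply: letters_inj.
have sP := size_letters P; have sQ := size_letters Q.
rewrite PE size_cat size_nseq in sP.
have kn : k < n by move: sP => /=; lia.
have QE : letters Q = nseq k true ++ drop k (letters Q).
  rewrite -[LHS](cat_take_drop k); congr (_ ++ _).
  apply: (@eq_from_nth _ false); first by rewrite size_takel ?size_nseq ?sQ // ltnW.
  move=> i; rewrite size_takel ?sQ ?(ltnW kn) // => ik.
  by rewrite nth_take // nth_nseq ik; apply: PQ; rewrite PE nth_ones ik.
have d0 : starts0 (drop k (letters Q)) by rewrite /starts0 -nth0 nth_drop addn0 Qk.
rewrite PE QE; congr (_ ++ _); rewrite -[LHS]blocksK -[RHS]blocksK; congr word_of.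
apply: (valid_maximal alpha0 alpha_lt alpha_add1) => //.
- exact: canonical_blocks0.
- exact: canonical_blocks0.
- by have := decreasing_letters Q; rewrite {1}QE decreasing_ones.
rewrite !blocksK; split; first by rewrite size_drop sQ; lia.
move=> i Hi; rewrite nth_drop; apply: PQ.
by rewrite PE nth_ones addKn Hi orbT.
Qed.

(** Every word strictly above [P] has a 1 at the first zero k of [P], hence lies above 1^(k+1)
    0^(n-k-1). That word is not below [P], so [P] is not the meet of two words other than itself. *)
Lemma irreducible_word_meet P : irreducible_word (letters P) -> meet_irreducible P.
Proof.
have [k [v [PE v0]]] := ones_prefix (letters P).
rewrite PE irreducible_word_ones; case: v v0 PE => [|[] v] // _ PE vv.
have sP := size_letters P; rewrite PE size_cat size_nseq /= in sP.
have Pk : nth false (letters P) k = false by rewrite PE nth_ones ltnn subnn.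
split=> [top|R S /is_meetE[PR PS inf]].
  have [|T TE] := @letters_surj (nseq n true) (size_nseq _ _).
    by rewrite -[nseq n true]cats0 decreasing_ones.
  have /le_letters/(_ k) := top T; rewrite TE Pk nth_nseq.
  by case: ltnP => [_ /(_ isT)|]; last lia.
have [RE|RN] := eqVneq P R; first by left.
have [SE|SN] := eqVneq P S; first by right.
have one U : (P <= U)%O -> P != U -> nth false (letters U) k.
  move=> PU; apply: contraNT => /negbTE Uk; apply/eqP.
  exact: above_first_zero PE vv PU Uk.
have [||T TE] := @letters_surj (nseq k.+1 true ++ nseq (n - k.+1) false).
- by rewrite size_cat !size_nseq; lia.
- by rewrite decreasing_ones decreasing_zeros.
have TU U : (P <= U)%O -> P != U -> (T <= U)%O.
  move=> PU NPU; apply/le_letters => i; rewrite TE nth_ones nth_nseq if_same orbF ltnS.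
  rewrite leq_eqVlt => /orP[/eqP ->|ik]; first exact: one.
  by move/le_letters: PU; apply; rewrite PE nth_ones ik.
have /le_letters/(_ k) := inf T (TU R PR RN) (TU S PS SN).
by rewrite Pk TE nth_ones ltnSn => /(_ isT).
Qed.

(** Otherwise [not_valid_split] gives [R], which is [P] with one more 1, and [S], which is [P] with
    an initial segment filled. The new 1 of [R] is a 0 in [S], so [P] is the meet of [R] and [S]
    while differing from both. *)
Lemma meet_irreducible_word P : meet_irreducible P -> irreducible_word (letters P).
Proof.
move=> [ntop irr]; have [k [v [PE v0]]] := ones_prefix (letters P).
have sP := size_letters P; rewrite PE size_cat size_nseq in sP.
rewrite PE irreducible_word_ones.
case: v v0 PE sP => [|[] v] // v0 PE sP.
  case: ntop => Q; apply/le_letters => i Qi; rewrite PE nth_ones.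
  suff ->: i < k by [].
  rewrite ltnNge; apply/negP => ki.
  by rewrite nth_default ?size_letters // in Qi; move: sP => /=; lia.
apply: contraT => /= nv.
have := decreasing_letters P; rewrite PE decreasing_ones => dv.
have [x1 [x2 [y []]]] := not_valid_split alpha0 alpha_lt (canonical_blocks0 v0) dv nv.
rewrite blocksK => vE x1N dR dS.
rewrite vE !size_cat /= in sP.
have [||R RE] := @letters_surj (nseq k true ++ x1 ++ x2 ++ true :: y).
- by rewrite !size_cat size_nseq /=.
- by rewrite decreasing_ones.
have [||S SE] := @letters_surj (nseq k true ++ nseq (size x1) true ++ x2 ++ false :: y).
- by rewrite !size_cat !size_nseq /=.
- by rewrite !decreasing_ones.
have PE' : letters P = nseq k true ++ x1 ++ x2 ++ false :: y by rewrite PE vE.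
have Rn i : nth false (letters R) i =
    nth false (letters P) i || (i == k + size x1 + size x2).
  rewrite RE PE' !nth_cat !size_nseq.
  case: ltnP => ik; first by rewrite nth_nseq ik.
  case: ltnP => ix1; first by case: eqP => //; rewrite ?orbF //; lia.
  case: ltnP => ix2; first by case: eqP => //; rewrite ?orbF //; lia.
  case E: (i - k - size x1 - size x2) => [|j] /=.
    by apply/esym/eqP; lia.
  by case: eqP => //; rewrite ?orbF //; lia.
have Sn i : nth false (letters S) i = nth false (letters P) i || (i < k + size x1).
  rewrite SE PE' !nth_cat !size_nseq.
  case: ltnP => ik; first by rewrite nth_nseq ik.
  case: ltnP => ix1; first by rewrite nth_nseq ix1; apply/esym/orP; right; lia.
  by rewrite (_ : i < k + size x1 = false) ?orbF //; lia.
have Pp : nth false (letters P) (k + size x1 + size x2) = false.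
  rewrite PE' !nth_cat !size_nseq.
  case: ltnP => ?; first lia.
  case: ltnP => ?; first lia.
  case: ltnP => ?; first lia.
  by rewrite (_ : _ - _ = 0) //; lia.
have Pk : nth false (letters P) k = false by rewrite PE nth_ones ltnn subnn.
have []: P = R \/ P = S.
- apply: irr; apply/is_meetE; split.
  + by apply/le_letters => i Pi; rewrite Rn Pi.
  + by apply/le_letters => i Pi; rewrite Sn Pi.
  move=> Q /le_letters QR /le_letters QS; apply/le_letters => i Qi.
  have := QR i Qi; rewrite Rn => /orP[//|/eqP iE].
  have := QS i Qi; rewrite Sn iE Pp /=; lia.
- by move=> E; have := Rn (k + size x1 + size x2); rewrite -E Pp eqxx.
- move=> E; have := Sn k; rewrite -E Pk.
  case: x1 x1N {vE dR RE SE PE' sP Rn Sn Pp} => //= ? ? _.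
  by rewrite addnS ltnS leq_addr.
Qed.

Lemma meet_irreducibleE P : `[< meet_irreducible P >] = irreducible_word (letters P).
Proof.
by apply/asboolP/idP; [apply: meet_irreducible_word|apply: irreducible_word_meet].
Qed.

End MeetIrreducible.

(** * Counting words *)

Fixpoint words n : seq bitseq :=
  if n is m.+1 then map (cons false) (words m) ++ map (cons true) (words m)
  else [:: [::]].

Lemma big_words (f : bitseq -> nat) n :
  \sum_(w <- words n.+1) f w =
  \sum_(w <- words n) f (false :: w) + \sum_(w <- words n) f (true :: w).
Proof. by rewrite /= big_cat !big_map. Qed.

Lemma mem_words n w : (w \in words n) = (size w == n).
Proof.
have inj x : injective (cons x : bitseq -> bitseq) by move=> ? ? [].
elim: n w => [|n IH] [|x w] //=; rewrite mem_cat.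
  by apply/negbTE/norP; split; apply/mapP => -[].
rewrite eqSS -IH; case: x.
  rewrite (mem_map (inj true)) orbC; case: (_ \in _) => //=.
  by apply/negbTE/mapP => -[].
rewrite (mem_map (inj false)); case: (_ \in _) => //=.
by apply/negbTE/mapP => -[].
Qed.

Lemma uniq_words n : uniq (words n).
Proof.
have inj x : injective (cons x : bitseq -> bitseq) by move=> ? ? [].
elim: n => //= n IH; rewrite cat_uniq !map_inj_uniq // IH andbT /=.
by apply/hasPn => _ /mapP[w _ ->]; apply/mapP => -[].
Qed.

Lemma eq_big_words (f g : bitseq -> nat) n : (forall w, size w = n -> f w = g w) ->
  \sum_(w <- words n) f w = \sum_(w <- words n) g w.
Proof. by move=> fg; apply: eq_big_seq => w; rewrite mem_words => /eqP/fg. Qed.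

Lemma sum_words_prefix (f : bitseq -> nat) v n : size v <= n ->
  \sum_(w <- words n) (take (size v) w == v) * f (drop (size v) w) =
  \sum_(w <- words (n - size v)) f w.
Proof.
elim: v n => [|x v IH] n /=.
  by move=> _; rewrite subn0; apply: eq_bigr => w _; rewrite take0 drop0 mul1n.
case: n => // n; rewrite ltnS subSS => /IH <-; rewrite big_words /=.
case: x; [rewrite big1 ?add0n // | rewrite addnC big1 ?add0n //].
Qed.

Lemma sum_delta n k (F : nat -> nat) : k < n -> \sum_(i < n) (i == k :> nat) * F i = F k.
Proof.
move=> kn; rewrite (bigD1 (Ordinal kn)) //= eqxx mul1n big1 ?addn0 // => i.
by rewrite -val_eqE => /negbTE /= ->.
Qed.

Lemma card_words n (T : finType) (letters : T -> bitseq) (A : pred T) (P : pred bitseq) :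
  injective letters -> (forall x, size (letters x) = n) ->
  (forall x, A x = P (letters x)) ->
  (forall w, size w = n -> P w -> exists x, letters x = w) ->
  #|[set x | A x]| = \sum_(w <- words n) P w.
Proof.
move=> inj szl AP surj; rewrite cardE -(size_map letters).
have -> : \sum_(w <- words n) P w = size (filter P (words n)).
  rewrite size_filter -sum1_count [RHS]big_mkcond.
  by apply: eq_bigr => w _; case: (P w).
apply/perm_size/uniq_perm; rewrite ?filter_uniq ?uniq_words ?map_inj_uniq ?enum_uniq //.
move=> w; rewrite mem_filter mem_words; apply/mapP/andP => [[x]|[Pw /eqP sw]].
  by rewrite mem_enum inE AP => Px ->; rewrite szl.
by have [x xE] := surj w sw Pw; exists x; rewrite // mem_enum inE AP xE.
Qed.

Local Open Scope ring_scope.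

(** * Generating series of languages *)

Section Series.
Variable R : comNzRingType.
Implicit Types f g : fps R.
Local Notation x := (fpsX R).

Lemma fcoefD f g n : fcoef (f + g) n = fcoef f n + fcoef g n.
Proof. by []. Qed.

Lemma fcoefB f g n : fcoef (f - g) n = fcoef f n - fcoef g n.
Proof. by []. Qed.

Lemma fcoef1 n : fcoef (1 : fps R) n = (n == 0%N)%:R.
Proof. by []. Qed.

Lemma fcoefXM f n : fcoef (x * f) n = if n is m.+1 then fcoef f m else 0.
Proof.
rewrite /= big_ord_recl /= mul0r add0r; case: n => [|n]; first by rewrite big_ord0.
rewrite big_ord_recl /= mul1r subSS subn0 big1 ?addr0 // => i _.
by rewrite mul0r.
Qed.

Lemma fcoefXnM f k n : fcoef (x ^+ k * f) n = if (n < k)%N then 0 else fcoef f (n - k).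
Proof.
elim: k n => [|k IH] n; first by rewrite mul1r subn0.
by rewrite exprS -mulrA fcoefXM; case: n => [|n] //; rewrite IH.
Qed.

Lemma fcoefXn k n : fcoef (x ^+ k) n = (n == k)%:R.
Proof.
rewrite -[x ^+ k]mulr1 fcoefXnM fcoef1.
by case: ltngtP => [nk|nk|->] //; rewrite ?subnn //= subn_eq0 leqNgt nk.
Qed.

Lemma fcoef_sum I (r : seq I) (P : pred I) (F : I -> fps R) n :
  fcoef (\sum_(i <- r | P i) F i) n = \sum_(i <- r | P i) fcoef (F i) n.
Proof. by elim/big_rec2: _ => // i y1 y2 _ <-. Qed.

Definition language_gf (f : bitseq -> nat) : fps R :=
  Fps (fun n => (\sum_(w <- words n) f w)%N%:R).

Definition block_gf (B : nat -> nat -> bool) : fps R :=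
  Fps (fun m => (\sum_(b < m.+1) B (m - b)%N b)%N%:R).

(** Cutting after the first block is bijective: a word that begins with 0 can follow a block with a,
    b > 0 without altering it. Lengths add, hence the product. *)
Lemma block_gf_concat (B : nat -> nat -> bool) (L : bitseq -> bool) :
  (forall a b, B a b -> (0 < a)%N && (0 < b)%N) -> (forall w, L w -> starts0 w) ->
  language_gf (fun w => if blocks w is (a, b) :: l then B a b && L (word_of l) else false)
    = block_gf B * language_gf L.
Proof.
move=> B0 L0; apply: fpsP => n /=.
under [RHS]eq_bigr do rewrite -natrM; rewrite -natr_sum; congr _%:R.
(* Sum over all cut points i and all numbers b of ones before the cut; only the values given by the
   first block of [w] can contribute. *)
transitivity (\sum_(w <- words n) \sum_(i < n.+1) \sum_(b < i.+1)
    B (i - b) b * ((take i w == zeros_ones (i - b) b) * L (drop i w)))%N.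
  apply: eq_big_words => w sw; case E: (blocks w) => [|[a b0] l].
    rewrite big1 // => i _; rewrite big1 // => b _.
    case Bb: (B _ _) => //; have := B0 _ _ Bb.
    have n0 : n = 0%N by rewrite -sw (blocks_nil E).
    by have := ltn_ord i; lia.
  have wE : w = zeros_ones a b0 ++ word_of l by rewrite -word_of_cons -E blocksK.
  have abn : (a + b0 < n.+1)%N by rewrite -sw wE size_cat size_zeros_ones; lia.
  pose C := B a b0 && L (word_of l).
  transitivity (\sum_(i < n.+1) (i == a + b0 :> nat)%N *
    \sum_(b < i.+1) (b == b0 :> nat) * C)%N.
    rewrite -/C (sum_delta (fun i => \sum_(b < i.+1) (b == b0 :> nat) * C)%N abn).
    by rewrite (sum_delta (fun=> nat_of_bool C)) // ltnS leq_addl.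
  apply: eq_bigr => i _; rewrite big_distrr; apply: eq_bigr => b _ /=.
  rewrite !mulnb; congr nat_of_bool; apply/idP/idP.
    move=> /and3P[/eqP iE /eqP bE /andP[Bab Ll]].
    have -> : (i - b)%N = a by lia.
    rewrite bE Bab iE wE -(size_zeros_ones a b0) take_size_cat // drop_size_cat //.
    by rewrite eqxx.
  move=> /and3P[Bib /eqP tE Ld]; have /andP[ib0 bb0] := B0 _ _ Bib.
  have := blocks_zeros_ones bb0 ib0 (L0 _ Ld); rewrite -tE cat_take_drop E.
  move=> [aE bE lE]; rewrite /C lE blocksK aE bE Bib Ld eqxx andbT andbT.
  by apply/eqP; have := ltn_ord b; lia.
rewrite exchange_big; apply: eq_bigr => i _ /=; rewrite exchange_big big_distrl /=.
apply: eq_bigr => b _; rewrite -big_distrr /=; congr (_ * _)%N.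
have sz : size (zeros_ones (i - b) b) = i.
  by rewrite size_zeros_ones subnK // -ltnS.
have := @sum_words_prefix (fun w => nat_of_bool (L w)) (zeros_ones (i - b) b) n.
by rewrite sz; apply; rewrite -ltnS.
Qed.

End Series.

(** * Generating functions *)

Section GeneratingFunctions.
Variable alpha : nat -> nat.
Variable R : comNzRingType.
Local Notation x := (fpsX R).
Local Notation t := (x ^+ (alpha 1).+1).

(** Slack and unslack blocks together are the blocks with b > 0 allowed in a valid list; when
    [alpha] is strictly increasing, tight blocks are unslack. *)
Definition tight_block a b := (0 < b)%N && (a == alpha b).
Definition slack_block a b := (0 < b)%N && (a == alpha b.+1).
Definition unslack_block a b := (0 < b)%N && (alpha b <= a < alpha b.+1)%N.

Definition tight_gf : fps R := block_gf R tight_block.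
Definition slack_gf : fps R := block_gf R slack_block.
Definition unslack_gf : fps R := block_gf R unslack_block.

(** The free bound N lets sums over different ranges be matched in [tight_gf_min_zeros]. *)
Lemma coef_tight_gf N m : (m < N)%N ->
  fcoef tight_gf m = (\sum_(b < N) ((0 < b) && (b + alpha b == m)))%N%:R.
Proof.
move=> mN; congr _%:R.
rewrite (@big_ord_widen _ _ _ m.+1 N (fun b => nat_of_bool (tight_block (m - b)%N b))) //.
rewrite big_mkcond; apply: eq_bigr => b _; rewrite /tight_block.
case: ltnP => bm; first by congr nat_of_bool; congr andb; lia.
by rewrite (_ : (_ == m) = false) ?andbF //; lia.
Qed.

Hypothesis alpha0 : alpha 0 = 1%N.
Hypothesis alpha_lt : forall b, (alpha b < alpha b.+1)%N.
Let alpha_pos b : (0 < alpha b)%N := alpha_gt0 alpha0 alpha_lt b.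

Lemma sum_blocks_between m k :
  (\sum_(b < k.+1) ((0 < b) && (alpha b + b <= m < alpha b.+1 + b.+1)) =
   (alpha 1 < m < alpha k.+1 + k.+1))%N.
Proof.
elim: k => [|k IH].
  by rewrite big_ord_recl big_ord0 /= addn0; case: andP => // -[]; lia.
rewrite big_ord_recr IH /=; have := alpha_lt k.+1.
have := alpha_homo alpha_lt (ltn0Sn k); lia.
Qed.

(** The intervals [alpha b + b, alpha (b + 1) + b + 1) with b >= 1 tile the integers above alpha 1,
    so each length m > alpha 1 has exactly one such block and no other length has any. *)
Lemma all_block_gf : (1 - x) * (unslack_gf + slack_gf) = t.
Proof.
have E m : fcoef (unslack_gf + slack_gf) m = (alpha 1 < m)%:R.
  rewrite fcoefD /= -natrD -big_split /=; congr _%:R.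
  have <- : (alpha 1 < m < alpha m.+1 + m.+1)%N = (alpha 1 < m)%N by lia.
  rewrite -sum_blocks_between; apply: eq_bigr => b _.
  rewrite /unslack_block /slack_block; have := ltn_ord b; have := alpha_lt b.
  by case: (posnP b) => //= ? ? ?; lia.
apply: fpsP => m; rewrite mulrBl mul1r fcoefB fcoefXM fcoefXn E.
case: m => [|m]; first by rewrite subr0.
by rewrite E eqSS ltnS; case: ltngtP => //= _; rewrite ?subr0 ?subrr.
Qed.

(** Appending a 1 to a slack block gives a tight one, and every tight block arises except the one
    with b = 1, of weight t. *)
Lemma slack_tight_gf : x * slack_gf = tight_gf - t.
Proof.
apply: fpsP => m; rewrite fcoefXM fcoefB fcoefXn.
case: m => [|m].
  by rewrite /= big_ord_recl big_ord0 subr0.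
apply/eqP; rewrite eq_sym subr_eq -natrD; apply/eqP; congr _%:R.
rewrite !big_ord_recl /= !add0n addnC /tight_block /slack_block /bump /=.
by congr addn; rewrite ?subn1 // eqSS.
Qed.

Definition valid_word (w : bitseq) := valid alpha (blocks w).
(** The words that may follow a slack block, including the empty one. *)
Definition valid_tight_word (w : bitseq) := starts_tight alpha (blocks w) && valid_word w.
Definition zero_word (w : bitseq) :=
  if blocks w is [:: (a, 0%N)] then (0 < a <= alpha 1)%N else false.

Definition valid_gf : fps R := language_gf R valid_word.
Definition valid_tight_gf : fps R := language_gf R valid_tight_word.
Definition zero_gf : fps R := language_gf R zero_word.

Lemma valid_word_starts0 w : valid_word w -> starts0 w.
Proof.
rewrite /valid_word; case: w => [|[] w] //=; have := alpha_pos.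
by case: (blocks w) => [|[[|a] b] l] /= H; rewrite leqNgt H.
Qed.

Lemma coef_zero_gf n : fcoef zero_gf n = (0 < n <= alpha 1)%N%:R.
Proof.
congr _%:R; pose c : nat := (0 < n <= alpha 1)%N.
transitivity (\sum_(w <- words n) (take n w == nseq n false) * c)%N.
  apply: eq_big_words => w sw; rewrite mulnb take_oversize ?sw //; congr nat_of_bool.
  apply/idP/andP => [|[/eqP -> H]].
    rewrite /zero_word; case E: (blocks w) => [|[a [|b]] [|]] //= H.
    move: (blocksK w); rewrite E word_of_cons /zeros_ones !cats0 => wE.
    by move: sw; rewrite -wE size_nseq => <-.
  by case: (n) H => // m; rewrite /zero_word blocks_zeros.
have := @sum_words_prefix (fun=> c) (nseq n false) n.
by rewrite size_nseq subnn /= big_seq1 => ->.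
Qed.

Lemma zero_gfE : (1 - x) * zero_gf = x - t.
Proof.
apply: fpsP => m; rewrite mulrBl mul1r !fcoefB fcoefXM fcoefXn !coef_zero_gf.
have fx : fcoef x m = (m == 1%N)%:R by [].
rewrite fx; case: m {fx} => [|m] //; rewrite coef_zero_gf eqSS eqSS.
case: (alpha 1) (alpha_pos 1) => // k _; case: m => [|m] /=; first by rewrite !subr0.
rewrite !ltnS !eqSS; case: ltngtP => //= _; rewrite ?subrr ?subr0 //.
Qed.

(** The cases for the first block exclude each other, so truth values add up in [nat] and
    [language_gfD] turns the equation into one of series. *)
Lemma valid_wordE w : (valid_word w = (w == [::]) + zero_word w
  + (if blocks w is (a, b) :: l then unslack_block a b && valid_word (word_of l) else false)
  + (if blocks w is (a, b) :: l then slack_block a b && valid_tight_word (word_of l)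
     else false)
  :> nat)%N.
Proof.
rewrite /valid_tight_word /valid_word /zero_word /unslack_block /slack_block.
have w0 : (w == [::]) = (blocks w == [::]).
  by apply/eqP/eqP => [->|/blocks_nil].
rewrite w0; case: (canonical_blocks w) => [|[b [l [-> _]]]]; last first.
  have := alpha_pos b.+1; have := alpha_pos b.+2; rewrite /=.
  by case: (alpha b.+1) => //= ?; case: (alpha b.+2).
case: (blocks w) => [|[a b] l] //= /and3P[a0 bl cl]; rewrite word_ofK //.
case: b bl => [/eqP ->|b _] /=; rewrite ?add0n.
  by rewrite alpha0 a0 implybT !andbT !addn0.
have := alpha_lt b.+1.
by case: (valid alpha l); case: starts_tight; rewrite ?andbT ?andbF ?implybT //=; lia.
Qed.

(** A tight block is not slack, so any valid word may follow it. *)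
Lemma valid_tight_wordE w : (valid_tight_word w = (w == [::])
  + (if blocks w is (a, b) :: l then tight_block a b && valid_word (word_of l) else false)
  :> nat)%N.
Proof.
rewrite /valid_tight_word /valid_word /tight_block.
have w0 : (w == [::]) = (blocks w == [::]).
  by apply/eqP/eqP => [->|/blocks_nil].
rewrite w0; case: (canonical_blocks w) => [|[b [l [-> _]]]]; last first.
  by have := alpha_pos b.+1; rewrite /=; case: (alpha b.+1).
case: (blocks w) => [|[a b] l] //= /and3P[a0 bl cl]; rewrite word_ofK //.
rewrite add0n [X in (X && _ : nat) = _]andbC; have lt := alpha_lt b.
by case: eqP => [->|_]; rewrite ?andbF // leqnn (ltnW lt) (ltn_eqF lt) andbT.
Qed.

Lemma language_gfD (f g : bitseq -> nat) :
  language_gf R (fun w => f w + g w)%N = language_gf R f + language_gf R g.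
Proof. by apply: fpsP => n; rewrite fcoefD /= -natrD big_split. Qed.

Lemma language_gf_nil : language_gf R (fun w => w == [::]) = 1.
Proof.
apply: fpsP => -[|n] /=; first by rewrite big_seq1.
by rewrite big_cat !big_map /= !big1.
Qed.

Lemma eq_language_gf (f g : bitseq -> nat) : f =1 g -> language_gf R f = language_gf R g.
Proof. by move=> fg; apply: fpsP => n /=; congr _%:R; apply: eq_bigr. Qed.

Lemma valid_gfE :
  valid_gf = 1 + zero_gf + unslack_gf * valid_gf + slack_gf * valid_tight_gf.
Proof.
rewrite -[LHS](eq_language_gf (fun w => esym (valid_wordE w))) !language_gfD.
rewrite language_gf_nil !block_gf_concat //.
- by move=> a b /andP[-> /eqP ->]; rewrite alpha_pos.
- by move=> w /andP[_ /valid_word_starts0].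
- move=> a b /andP[-> /andP[H _]]; rewrite andbT; exact: leq_trans (alpha_pos b) H.
- exact: valid_word_starts0.
Qed.

Lemma valid_tight_gfE : valid_tight_gf = 1 + tight_gf * valid_gf.
Proof.
rewrite -[LHS](eq_language_gf (fun w => esym (valid_tight_wordE w))) language_gfD.
rewrite language_gf_nil block_gf_concat //; last exact: valid_word_starts0.
by move=> a b /andP[-> /eqP ->]; rewrite alpha_pos.
Qed.

Definition irreducible_gf : fps R := language_gf R (irreducible_word alpha).

(** Multiplying by 1 - x removes the irreducible words that begin with 1; the others are the
    nonempty valid words. *)
Lemma irreducible_gfE : (1 - x) * irreducible_gf = valid_gf - 1.
Proof.
apply: fpsP => n; rewrite mulrBl mul1r !fcoefB fcoefXM fcoef1.
case: n => [|n]; first by rewrite /= !big_seq1 !subrr.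
rewrite subr0; apply/eqP; rewrite subr_eq -natrD; apply/eqP; congr _%:R.
rewrite !big_words; congr addn.
rewrite [X in (_ + X)%N]big1 ?addn0 // => w _; apply/eqP; rewrite eqb0.
by apply/negP => /valid_word_starts0.
Qed.

Lemma irreducible_gf_rational :
  let A := tight_gf in
  irreducible_gf *
    ((x - 1) * (t * (1 - A) + A * x * t + (x - 1) * (x + A - A ^+ 2))) =
  t * (x - 1) * A - (x - 1) * A ^+ 2 + x ^+ 2.
Proof.
move=> A; set D := t * (1 - A) + _ + _.
have h7 := irreducible_gfE; have h6 := valid_tight_gfE; have h5 := valid_gfE.
have h4 := zero_gfE; have h3 := slack_tight_gf; have h1 := all_block_gf.
rewrite h6 in h5; rewrite -/A in h3 h5.
set L := valid_gf in h5 h7; set Z := zero_gf in h4 h5.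
set S := slack_gf in h1 h3 h5; set N := unslack_gf in h1 h5.
have -> : irreducible_gf * ((x - 1) * D) = (1 - L) * D.
  have -> : irreducible_gf * ((x - 1) * D) = - ((1 - x) * irreducible_gf) * D by ring.
  by rewrite h7; ring.
(* After multiplication by x (1 - x), the block series enter only through the known products (1 - x)
   Z, (1 - x) (N + S) and x S. *)
have: x * (1 - x) * (L - (1 + Z + N * L + S * (1 + A * L))) = 0 by rewrite -h5 subrr mulr0.
have -> : x * (1 - x) * (L - (1 + Z + N * L + S * (1 + A * L))) =
  x * (1 - x) * (L - 1) - x * ((1 - x) * Z) - x * ((1 - x) * (N + S)) * L
   + (1 - x) * (x * S) * (L - 1 - A * L) by ring.
rewrite h1 h3 h4 => h; apply/eqP; rewrite -subr_eq0; apply/eqP.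
by rewrite -h /D; ring.
Qed.

Lemma tight_gf_divX2 : exists B, tight_gf = x ^+ 2 * B.
Proof.
exists (Fps (fun n => fcoef tight_gf n.+2)); apply: fpsP => m.
rewrite fcoefXnM; case: ltnP => [m2|m2]; last by rewrite -[in LHS](subnK m2) addn2.
rewrite (coef_tight_gf m2) big1 // => b _; have := alpha_pos b.
by case: (posnP b) => //= b0 p; have -> : (b + alpha b == m)%N = false by lia.
Qed.

(** The coefficient of x is -1: both t and the tight series are divisible by x^2, so only (x - 1) x
    contributes. *)
Lemma denominator_neq0 :
  t * (1 - tight_gf) + tight_gf * x * t + (x - 1) * (x + tight_gf - tight_gf ^+ 2) != 0.
Proof.
have [B] := tight_gf_divX2; move: tight_gf => A AE.
case: (alpha 1) (alpha_pos 1) => // k _.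
pose F := x ^+ k * (1 - A) + A * x * x ^+ k + 1 + (x - 1) * (B - x ^+ 2 * B ^+ 2).
have -> : x ^+ k.+2 * (1 - A) + A * x * x ^+ k.+2 + (x - 1) * (x + A - A ^+ 2)
    = x * (x * F - 1).
  by rewrite /F !exprS AE; ring.
apply/eqP => /(congr1 (fun f => fcoef f 1)).
rewrite fcoefXM fcoefB fcoefXM fcoef1 sub0r => /eqP.
by rewrite oppr_eq0 oner_eq0.
Qed.

End GeneratingFunctions.

(** * The thresholds for q = c / d *)

Definition min_zeros (c d b : nat) : nat := (b * d %/ c).+1.

Section MinZeros.
Variables c d : nat.
Hypothesis c_gt0 : (0 < c)%N.

Lemma min_zeros0 : min_zeros c d 0 = 1%N.
Proof. by rewrite /min_zeros mul0n div0n. Qed.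

Lemma min_zeros_add1 b : (min_zeros c d b.+1 <= min_zeros c d b + min_zeros c d 1)%N.
Proof.
have := leq_divDl c (b * d) d; rewrite /min_zeros mulSn mul1n addnC; lia.
Qed.

Lemma min_zeros_period b : min_zeros c d (c + b) = (min_zeros c d b + d)%N.
Proof. by rewrite /min_zeros mulnDl mulnC divnMDl // addnC. Qed.

(** By [min_zeros_period], adding c to b lengthens the tight block by c + d, so the factor 1 -
    x^(c+d) leaves only the blocks with 1 <= b <= c. *)
Lemma tight_gf_min_zeros (R : comNzRingType) :
  (1 - fpsX R ^+ (c + d)) * tight_gf (min_zeros c d) R =
  \sum_(1 <= i < c.+1) fpsX R ^+ (1 + i + (i * d) %/ c)%N.
Proof.
apply: fpsP => m; rewrite mulrBl mul1r fcoefB fcoefXnM fcoef_sum.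
have cT := @coef_tight_gf (min_zeros c d) R.
have mN : (m < c.+1 + m.+1)%N by lia.
rewrite (cT _ _ mN) big_split_ord natrD.
have -> : (\sum_(i < c.+1) ((0 < i) && (i + min_zeros c d i == m)))%N%:R =
    \sum_(1 <= i < c.+1) fcoef (fpsX R ^+ (1 + i + i * d %/ c)) m.
  rewrite big_add1 big_mkord natr_sum big_ord_recl add0r; apply: eq_bigr => i _.
  rewrite fcoefXn lift0 ltn0Sn /min_zeros eq_sym.
  by rewrite add1n addnS !addSn.
rewrite -addrA -[RHS]addr0; congr +%R.
have E j : (c.+1 + j + min_zeros c d (c.+1 + j) =
    j.+1 + min_zeros c d j.+1 + (c + d))%N.
  by rewrite addSnnS min_zeros_period; lia.
case: ltnP => mcd.
  rewrite big1 ?subr0 // => j _; rewrite E; apply/eqP; rewrite eqb0; lia.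
(* Without its vanishing term b = 0, this range has the m + 1 terms of the other side. *)
rewrite (cT m.+2 (m - (c + d))%N); last by lia.
apply/eqP; rewrite subr_eq0; apply/eqP; congr _%:R.
rewrite [RHS]big_ord_recl add0n; apply: eq_bigr => j _.
by rewrite lift0 -[_ == (_ - _)%N](eqn_add2r (c + d)) subnK // -E.
Qed.

Hypothesis le_cd : (c <= d)%N.

Lemma min_zeros_lt b : (min_zeros c d b < min_zeros c d b.+1)%N.
Proof.
have := leq_div2r c (_ : b * d + c <= b.+1 * d)%N.
rewrite divnDr // divnn c_gt0 /min_zeros => H; have := H ltac:(lia); lia.
Qed.

Hypothesis d_gt0 : (0 < d)%N.

Lemma min_zerosP a b :
  (b%:R < c%:R / d%:R * a%:R :> rat) = (min_zeros c d b <= a)%N.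
Proof.
rewrite mulrAC ltr_pdivlMr ?ltr0n // -!natrM ltr_nat /min_zeros ltn_divLR //.
by rewrite mulnC [(a * c)%N]mulnC [(d * b)%N]mulnC.
Qed.

Lemma meet_irreducible_gfE : meet_irreducible_gf (c%:R / d%:R) =
  irreducible_gf (min_zeros c d) rat.
Proof.
(* At index 0 both sides vanish, as [irreducible_word] is false on the empty word. *)
apply: fpsP => -[|n] /=; first by rewrite big_seq1.
congr _%:R; rewrite /num_meet_irreducible.
apply: (card_words (@letters_inj _ n.+1) (@size_letters _ n.+1)) => [P|w sw].
  exact: (meet_irreducibleE min_zeros0 min_zeros_lt min_zeros_add1 min_zerosP).
move=> iw; apply: (letters_surj min_zeros0 min_zerosP sw).
have [k [v [wE v0]]] := ones_prefix w.
rewrite wE irreducible_word_ones in iw; rewrite wE decreasing_ones.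
by case: v v0 iw {wE} => [|[] v] // _ /valid_good.
Qed.

End MinZeros.

(** * Transfer to the field of fractions *)

Theorem mainTheorem12 (c d : nat) (hc : (0 < c)%N) (hd : (0 < d)%N) :
  let q : rat := c%:R / d%:R in
  0 < q <= 1 ->
  let u := (d %/ c)%N in
  let x : {fraction fps rat} := tofrac (fpsX rat) in
  let A := (\sum_(1 <= i < c.+1) x ^+ (1 + i + (i * d) %/ c)%N)
             / (1 - x ^+ (c + d)%N) in
  let M : {fraction fps rat} := tofrac (meet_irreducible_gf q) in
  M = (x ^+ (2 + u)%N * (x - 1) * A - (x - 1) * A ^+ 2 + x ^+ 2)
      / ((x - 1) * (x ^+ (2 + u)%N * (1 - A) + A * x ^+ (3 + u)%N
                    + (x - 1) * (x + A - A ^+ 2))).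
Proof.
move=> q /andP[_ q1] u x A M.
have cd : (c <= d)%N by move: q1; rewrite ler_pdivrMr ?ltr0n // mul1r ler_nat.
have lt := min_zeros_lt hc cd; have a0 := min_zeros0 c d.
pose T := tight_gf (min_zeros c d) rat.
have XnB1_neq0 n : (0 < n)%N -> 1 - fpsX rat ^+ n != 0.
  move=> n0; apply/eqP => /(congr1 (fun f => fcoef f 0)).
  by rewrite fcoefB fcoef1 fcoefXn eq_sym (gtn_eqF n0) subr0 => /eqP; rewrite oner_eq0.
have AE : A = tofrac T.
  have := tight_gf_min_zeros d hc rat => /(congr1 (@tofrac _)).
  rewrite rmorphM rmorphB rmorphXn rmorph1 rmorph_sum /=.
  under eq_bigr do rewrite rmorphXn.
  move=> E; rewrite /A -E mulrAC divff ?mul1r //.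
  rewrite -rmorphXn -[1](rmorph1 (@tofrac (fps rat))) -rmorphB.
  by rewrite tofrac_eq0 XnB1_neq0 // addn_gt0 hc.
(* The exponent 2 + u is alpha 1 + 1, because alpha 1 = floor (d / c) + 1. *)
have tE : (min_zeros c d 1).+1 = (2 + u)%N by rewrite /min_zeros mul1n.
have := irreducible_gf_rational rat a0 lt; have := denominator_neq0 rat a0 lt.
rewrite tE -/T -(meet_irreducible_gfE hc cd hd) -/q => D0 E.
have x1 : fpsX rat - 1 != 0 by rewrite -oppr_eq0 opprB; apply: (XnB1_neq0 1%N).
have tofracE := (rmorphXn (@tofrac (fps rat)), rmorphD (@tofrac (fps rat)),
  rmorphM (@tofrac (fps rat)), rmorphN (@tofrac (fps rat)), rmorph1 (@tofrac (fps rat))).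
have -> : A * x ^+ (3 + u) = A * x * x ^+ (2 + u) by rewrite -mulrA -exprS.
have := mulf_neq0 x1 D0; rewrite -tofrac_eq0 => nz.
(* With the nonzero denominator cleared, the claim is the image of [irreducible_gf_rational]. *)
rewrite !tofracE in nz; rewrite AE; apply: (canRL (mulfK nz)).
by move: E => /(congr1 (@tofrac _)); rewrite !tofracE.
Qed.
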